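(* Let $m\geq 3$. Then the intersection posets $L(\mathcal{B}_m)$ and $L(\mathcal{C}_m)$ of the Shi arrangements of type B and type C, regarded as affine hyperplane arrangements in $\mathbb{R}^m$, are not isomorphic as posets.
   Context: The Shi arrangements are $\mathcal{B}_m=\{\{x_i=0\},\{x_i=1\}\mid 1\le i\le m\}\cup\{\{x_i\pm x_j=0\},\{x_i\pm x_j=1\}\mid 1\leq i<j\leq m\}$ and $\mathcal{C}_m=\{\{2x_i=0\},\{2x_i=1\}\mid 1\le i\le m\}\cup\{\{x_i\pm x_j=0\},\{x_i\pm x_j=1\}\mid 1\leq i<j\leq m\}$. For an affine arrangement $\mathcal{A}$, the intersection poset is $L(\mathcal{A})=\{\bigcap_{H\in\mathcal{S}}H\mid \mathcal{S}\subseteq\mathcal{A},\ \bigcap_{H\in\mathcal{S}}H\neq\emptyset\}$ (the empty intersection being the whole space), partially ordered by reverse inclusion. Two posets are isomorphic if there is a bijection $\varphi$ between them such that $x\le y$ if and only if $\varphi(x)\le\varphi(y)$. *)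

(* Defs.v *)
From mathcomp Require Import all_boot all_order all_algebra.
From mathcomp Require Import classical_sets functions reals.

Set Implicit Arguments.
Unset Strict Implicit.
Unset Printing Implicit Defensive.

Import Order.TTheory GRing.Theory Num.Theory.

Local Open Scope classical_set_scope.
Local Open Scope ring_scope.

Section Posets.
Variables (T U : Type).

(* A poset is given by a carrier [A : set T] together with its order [leA],
   of which only the restriction to [A] matters. *)
Definition poset_isomorphic (A : set T) (leA : T -> T -> Prop)
    (B : set U) (leB : U -> U -> Prop) : Prop :=
  exists2 phi : T -> U, set_bij A B phi &
    forall x y : T, A x -> A y -> (leA x y <-> leB (phi x) (phi y)).

End Posets.

Section Arrangements.
Variables (R : realType) (m : nat).

Definition arrangement := set (set 'rV[R]_m).

(* For [S = set0] the intersection is the whole space [setT]. *)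
Definition intersection_poset (A : arrangement) : set (set 'rV[R]_m) :=
  [set X | exists2 S : set (set 'rV[R]_m), S `<=` A &
           X = \bigcap_(H in S) H /\ X !=set0].

Definition reverse_inclusion (X Y : set 'rV[R]_m) : Prop := Y `<=` X.

Definition isomorphic_intersection_posets (A B : arrangement) : Prop :=
  poset_isomorphic (intersection_poset A) reverse_inclusion
                   (intersection_poset B) reverse_inclusion.

Definition shi_pairs : arrangement :=
  [set H | exists i j : 'I_m, (i < j)%N /\
     [\/ H = [set x : 'rV[R]_m | x 0 i + x 0 j = 0],
         H = [set x : 'rV[R]_m | x 0 i - x 0 j = 0],
         H = [set x : 'rV[R]_m | x 0 i + x 0 j = 1] |
         H = [set x : 'rV[R]_m | x 0 i - x 0 j = 1]]].

Definition shi_B : arrangement :=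
  [set H | exists i : 'I_m,
     H = [set x : 'rV[R]_m | x 0 i = 0] \/
     H = [set x : 'rV[R]_m | x 0 i = 1]] `|` shi_pairs.

Definition shi_C : arrangement :=
  [set H | exists i : 'I_m,
     H = [set x : 'rV[R]_m | 2 * x 0 i = 0] \/
     H = [set x : 'rV[R]_m | 2 * x 0 i = 1]] `|` shi_pairs.

End Arrangements.

Arguments shi_pairs : clear implicits.
Arguments shi_B : clear implicits.
Arguments shi_C : clear implicits.

(* Main.v *)
Require Import Defs.
From mathcomp Require Import all_boot all_order all_algebra.
From mathcomp Require Import classical_sets functions reals.
From mathcomp Require Import boolp.
From mathcomp Require Import zify ring lra.

Set Implicit Arguments.
Unset Strict Implicit.
Unset Printing Implicit Defensive.

Import Order.TTheory GRing.Theory Num.Theory.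

Local Open Scope classical_set_scope.
Local Open Scope ring_scope.

(** Call a hyperplane of an arrangement rich if it is one of four or more
    hyperplanes of the arrangement containing a common flat of codimension two.
    The intersection poset knows which hyperplanes are rich: its atoms are the
    hyperplanes ([atomE]), and for atoms [H], [H1], [H2] the inclusion of
    [H `&` H1] in [H2] says that every common upper bound of [H] and [H1] lies
    above [H2].  So an isomorphism of posets maps rich hyperplanes to rich
    hyperplanes ([isomorphism_quadruple_pencil]).

    Four hyperplanes through a flat of codimension two come from a rank two
    root subsystem of type B or C, and there the levels of [x_i] make the
    difference: 0 and 1 in type B, 0 and 1/2 in type C.  In type B, for [a <
    b] and [c] equal to 0 or 1, the hyperplanes [x_a = c], [x_b = 0], [x_a -
    x_b = c] and [x_a + x_b = c] share a flat.  Letting [a] and [b] vary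
    covers every hyperplane except [x_m = 1], so at most one hyperplane
    fails to be rich ([shi_B_in_quadruple_pencil]).  In type C, no
    hyperplane [x_i - x_j = 1] is rich ([diff_one_not_in_quadruple_pencil]):
    on it [x_i = x_j + 1], so hyperplanes that cut it in the same flat have
    roots that agree up to sign once [x_i] and [x_j] are identified.  Away
    from [2 x_j] at most two positive roots have the same image up to sign.
    Over [2 x_j] lie the three roots [2 x_i], [x_i + x_j], [2 x_j], but the
    equations of the outer two at levels 0 or 1 contradict [2 x_i = 2 x_j +
    2].  With at least three coordinates, [x_1 - x_2 = 1] and [x_1 - x_3 =
    1] are two hyperplanes that are not rich, one too many for type B.  *)

(** * Affine hyperplanes *)

Section Hyperplanes.
Variables (R : realType) (m : nat).
Implicit Types (X Y H K : set 'rV[R]_m) (A B : arrangement R m).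

(** Normalizing [f] by a vector of value 1 expresses that [f] is nonzero in the
    form in which it is used, as a direction transverse to [X]. *)
Definition is_hyperplane X := exists (f : 'rV[R]_m -> R) (c : R) (v : 'rV[R]_m),
  [/\ scalar f, f v = 1 & X = [set x | f x = c]].

Lemma scalar_comb (i j : 'I_m) (s t : R) :
  scalar (fun x : 'rV[R]_m => s * x 0 i + t * x 0 j).
Proof. by move=> a x y /=; rewrite !mxE; ring. Qed.

Lemma is_hyperplane_comb (i j : 'I_m) (s t c : R) (v : 'rV[R]_m) :
  s * v 0 i + t * v 0 j != 0 ->
  is_hyperplane [set x : 'rV[R]_m | s * x 0 i + t * x 0 j = c].
Proof.
set d := (X in X != 0) => d0.
exists (fun x => s * x 0 i + t * x 0 j), c, (d^-1 *: v); split => //.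
  exact: scalar_comb.
by rewrite !mxE -(mulVf d0) /d; ring.
Qed.

Lemma hyperplane_neq0 X : is_hyperplane X -> X !=set0.
Proof.
move=> [f [c [v [lf fv ->]]]]; exists (c *: v) => /=.
have f0 : f 0 = 0 by have := lf (-1) 0 0; rewrite scaler0 addr0; lra.
by have := lf c v 0; rewrite fv f0 !addr0 mulr1.
Qed.

Lemma hyperplane_neqT X : is_hyperplane X -> X <> setT.
Proof.
move=> [f [c [v [lf fv ->]]]] XT.
have inX x : f x = c by have : [set: 'rV[R]_m] x by []; rewrite -XT.
have := lf 1 v v; rewrite mul1r scale1r fv.
by have := inX v; rewrite fv inX => <-; lra.
Qed.

(** If [f x = c] forces [g x = d], then [g] vanishes on the kernel of [f], so
    [g] is a multiple of [f], and both equations have the same solutions. *)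
Lemma hyperplane_antichain X Y :
  is_hyperplane X -> is_hyperplane Y -> X `<=` Y -> X = Y.
Proof.
move=> [f [c [v [lf fv ->]]]] [g [d [w [lg gw ->]]]] sub.
have f0 : f 0 = 0 by have := lf (-1) 0 0; rewrite scaler0 addr0; lra.
have g0 : g 0 = 0 by have := lg (-1) 0 0; rewrite scaler0 addr0; lra.
have fZ a x : f (a *: x) = a * f x by have := lf a x 0; rewrite f0 !addr0.
have gZ a x : g (a *: x) = a * g x by have := lg a x 0; rewrite g0 !addr0.
have gv x : g x = d + (f x - c) * g v.
  have /sub /= : f ((c - f x) *: v + x) = c by rewrite lf fv; ring.
  by rewrite lg; lra.
have dE : d = c * g v by move: (gv 0); rewrite g0 f0; lra.
have gv0 : g v != 0.
  by apply/eqP => gv0; move: (gv w); rewrite gw dE gv0 !mulr0; lra.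
apply/seteqP; split=> x /= => [/sub //|gx].
have /eqP : (f x - c) * g v = 0 by move: (gv x); rewrite gx; lra.
by rewrite mulf_eq0 (negbTE gv0) orbF subr_eq0 => /eqP.
Qed.

End Hyperplanes.

(** * Atoms of the intersection poset *)

Section Atoms.
Variables (R : realType) (m : nat).
Implicit Types (X Y H K : set 'rV[R]_m) (A B : arrangement R m).

Definition atom (L : set (set 'rV[R]_m)) X :=
  [/\ L X, X <> setT & forall Y, L Y -> X `<=` Y -> Y <> setT -> Y = X].

Lemma intersection_posetT A : intersection_poset A setT.
Proof. by exists set0 => //; rewrite bigcap_set0; split=> //; exists 0. Qed.

Lemma intersection_poset_meet A H K : A H -> A K -> H `&` K !=set0 ->
  intersection_poset A (H `&` K).
Proof.
move=> AH AK HK0; exists [set X | X = H \/ X = K]; first by move=> X [] ->.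
split=> //; apply/seteqP; split=> [x [xH xK] X [] -> //|x xHK].
by split; apply: xHK; [left|right].
Qed.

Lemma intersection_poset_hyperplane A H : A H -> H !=set0 ->
  intersection_poset A H.
Proof. by move=> AH; have := @intersection_poset_meet A H H AH AH; rewrite setIid. Qed.

(** An atom is contained in some hyperplane of [A], hence equals it by
    minimality.  Conversely an intersection that contains the hyperplane [X] is
    an intersection of hyperplanes containing [X], and these all equal [X]
    because hyperplanes are pairwise incomparable. *)
Lemma atomE A X : A `<=` @is_hyperplane R m ->
  atom (intersection_poset A) X <-> A X.
Proof.
move=> Ahyp; split=> [[[S SA [XE X0]] XT Xmin]|AX].
  have [[H SH]|/forallNP S0] := pselect (exists H, S H).
    have AH := SA _ SH; rewrite -(Xmin H) //.
    - exact/intersection_poset_hyperplane/hyperplane_neq0/Ahyp.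
    - by rewrite XE => x; apply.
    - exact/hyperplane_neqT/Ahyp.
  by case: XT; rewrite XE; apply/seteqP; split=> // x _ H /S0.
have hX := Ahyp _ AX; split.
- exact/intersection_poset_hyperplane/hyperplane_neq0.
- exact: hyperplane_neqT.
- move=> Y [S SA [-> _]] XS ST.
  have SX H : S H -> X = H.
    move=> SH; apply: hyperplane_antichain => //; first exact/Ahyp/SA.
    by move=> x /XS; apply.
  apply/seteqP; split=> // x xS.
  have [[H SH]|/forallNP S0] := pselect (exists H, S H).
    by rewrite (SX _ SH); apply: xS.
  by case: ST; apply/seteqP; split=> // y _ H /S0.
Qed.

(** The shared flat has codimension two because it is [H `&` H1]; writing it
    this way makes richness expressible in the poset without a notion of
    rank. *)
Definition in_quadruple_pencil A H := exists H1 H2 H3,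
  [/\ [/\ A H1, A H2 & A H3],
      [/\ H <> H1, H <> H2 & H <> H3],
      [/\ H1 <> H2, H1 <> H3 & H2 <> H3],
      H `&` H1 !=set0 & H `&` H1 `<=` H2 `&` H3].

(** The whole space is the least element, so it is preserved by [phi]; being an
    atom is then a property of the order alone. *)
Lemma isomorphism_hyperplanes A B phi :
  A `<=` @is_hyperplane R m -> B `<=` @is_hyperplane R m ->
  set_bij (intersection_poset A) (intersection_poset B) phi ->
  (forall X Y, intersection_poset A X -> intersection_poset A Y ->
    (reverse_inclusion X Y <-> reverse_inclusion (phi X) (phi Y))) ->
  forall X, intersection_poset A X -> (A X <-> B (phi X)).
Proof.
move=> hA hB [phiL phi_inj phi_surj] mono.
have injE X Y : intersection_poset A X -> intersection_poset A Y ->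
    phi X = phi Y -> X = Y by move=> AX AY; apply: phi_inj; rewrite inE.
have phiT : phi setT = setT.
  have [Z AZ ZT] := phi_surj _ (intersection_posetT B).
  have : phi Z `<=` phi setT by apply: (mono setT Z (intersection_posetT A) AZ).1.
  by rewrite ZT => TphiT; apply/seteqP.
move=> X AX; rewrite -(atomE X hA) -(atomE (phi X) hB); split.
  move=> [_ XT Xmin]; split; first exact: phiL.
    by rewrite -phiT => /(injE _ _ AX (intersection_posetT A)).
  move=> Y BY; have [Z AZ <-] := phi_surj _ BY => XZ ZT.
  congr phi; apply: Xmin => //; first exact/(mono Z X).
  by move=> ZE; apply: ZT; rewrite ZE.
move=> [_ XT Xmin]; split=> //; first by move=> XE; apply: XT; rewrite XE.
move=> Y AY XY YT; apply: (injE Y X AY AX); apply: Xmin; first exact: phiL.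
  exact/(mono Y X).
by rewrite -phiT => /(injE _ _ AY (intersection_posetT A)).
Qed.

(** The flat [phi H `&` phi H1] is the image of some element [Z] of the first
    poset.  Then [Z] lies in [H] and in [H1], hence in [H2] and in [H3], and
    applying [phi] gives the inclusions on the other side. *)
Lemma isomorphism_quadruple_pencil A B phi :
  A `<=` @is_hyperplane R m -> B `<=` @is_hyperplane R m ->
  set_bij (intersection_poset A) (intersection_poset B) phi ->
  (forall X Y, intersection_poset A X -> intersection_poset A Y ->
    (reverse_inclusion X Y <-> reverse_inclusion (phi X) (phi Y))) ->
  forall H, A H -> in_quadruple_pencil A H -> in_quadruple_pencil B (phi H).
Proof.
move=> hA hB bij mono H AH [H1 [H2 [H3]]].
move=> [[A1 A2 A3] [n1 n2 n3] [n12 n13 n23] ne sub].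
have atoms := isomorphism_hyperplanes hA hB bij mono.
have [phiL phi_inj phi_surj] := bij.
have inL X : A X -> intersection_poset A X.
  by move=> AX; apply/intersection_poset_hyperplane/hyperplane_neq0/hA.
have inB X : A X -> B (phi X) by move=> AX; apply/atoms; first exact: inL.
have neq X Y : A X -> A Y -> X <> Y -> phi X <> phi Y.
  by move=> AX AY nXY /phi_inj XY; apply: nXY; apply: XY; rewrite inE; exact: inL.
have AHH1 := intersection_poset_meet AH A1 ne.
have [_ _ [_ [x xHH1]]] := phiL _ AHH1.
have ne' : phi H `&` phi H1 !=set0.
  exists x; split.
    by apply: (mono H (H `&` H1) (inL _ AH) AHH1).1 => // y [].
  by apply: (mono H1 (H `&` H1) (inL _ A1) AHH1).1 => // y [].
exists (phi H1), (phi H2), (phi H3); split => //.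
- by split; exact: inB.
- by split; exact: neq.
- by split; exact: neq.
have [Z AZ ZE] := phi_surj _ (intersection_poset_meet (inB _ AH) (inB _ A1) ne').
have ZH : Z `<=` H.
  by apply: (mono H Z (inL _ AH) AZ).2; rewrite ZE => y [].
have ZH1 : Z `<=` H1.
  by apply: (mono H1 Z (inL _ A1) AZ).2; rewrite ZE => y [].
rewrite -ZE subsetI; split.
  by apply: (mono H2 Z (inL _ A2) AZ).1 => y Zy; have [] := sub y (conj (ZH _ Zy) (ZH1 _ Zy)).
by apply: (mono H3 Z (inL _ A3) AZ).1 => y Zy; have [] := sub y (conj (ZH _ Zy) (ZH1 _ Zy)).
Qed.

End Atoms.

(** * Type B: all hyperplanes but one are rich *)

Section TypeB.
Variables (R : realType) (m : nat).
Implicit Types (H K : set 'rV[R]_m) (i j k l a b : 'I_m) (c : R).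

Definition pair_row a b (u v : R) : 'rV[R]_m :=
  \row_k (if k == a then u else if k == b then v else 0).

Lemma pair_rowl a b u v : pair_row a b u v 0 a = u.
Proof. by rewrite mxE eqxx. Qed.

Lemma pair_rowr a b u v : (a < b)%N -> pair_row a b u v 0 b = v.
Proof.
by move=> ab; rewrite mxE eqxx; case: eqP => // ba; rewrite ba ltnn in ab.
Qed.

Lemma shi_pairs_hyperplane : shi_pairs R m `<=` @is_hyperplane R m.
Proof.
move=> H [i [j [ij HE]]].
have hyp t c : is_hyperplane [set x : 'rV[R]_m | x 0 i + t * x 0 j = c].
  have -> : [set x : 'rV[R]_m | x 0 i + t * x 0 j = c] =
            [set x | 1 * x 0 i + t * x 0 j = c].
    by apply/funext => x /=; rewrite mul1r.
  apply: (@is_hyperplane_comb _ _ i j _ _ _ (pair_row i j 1 0)).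
  by rewrite pair_rowl pair_rowr // mulr1 mulr0 addr0 oner_eq0.
have hypD c : is_hyperplane [set x : 'rV[R]_m | x 0 i + x 0 j = c].
  by have := hyp 1 c; under eq_fun do rewrite mul1r.
have hypB c : is_hyperplane [set x : 'rV[R]_m | x 0 i - x 0 j = c].
  by have := hyp (-1) c; under eq_fun do rewrite mulN1r.
by case: HE => ->.
Qed.

Lemma shi_B_hyperplane : shi_B R m `<=` @is_hyperplane R m.
Proof.
move=> H [[i iH]|]; last exact: shi_pairs_hyperplane.
have hyp c : is_hyperplane [set x : 'rV[R]_m | x 0 i = c].
  have -> : [set x : 'rV[R]_m | x 0 i = c] = [set x | 1 * x 0 i + 0 * x 0 i = c].
    by apply/funext => x /=; rewrite mul1r mul0r addr0.
  apply: (@is_hyperplane_comb _ _ i i _ _ _ (pair_row i i 1 0)).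
  by rewrite pair_rowl mulr1 mul0r addr0 oner_eq0.
by case: iH => ->.
Qed.

(** The four hyperplanes restrict to four lines in the plane of the coordinates
    [a] and [b], all passing through the point with coordinates [c] and 0; any
    two of the equations imply the other two. *)
Lemma shi_B_quadruple a b c H : (a < b)%N -> c = 0 \/ c = 1 ->
  [\/ H = [set x : 'rV[R]_m | x 0 a = c], H = [set x : 'rV[R]_m | x 0 b = 0],
      H = [set x : 'rV[R]_m | x 0 a - x 0 b = c] |
      H = [set x : 'rV[R]_m | x 0 a + x 0 b = c]] ->
  in_quadruple_pencil (shi_B R m) H.
Proof.
move=> ab c01.
pose Ha := [set x : 'rV[R]_m | x 0 a = c]; pose Hb := [set x : 'rV[R]_m | x 0 b = 0].
pose Hm := [set x : 'rV[R]_m | x 0 a - x 0 b = c].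
pose Hp := [set x : 'rV[R]_m | x 0 a + x 0 b = c].
rewrite -/Ha -/Hb -/Hm -/Hp.
have Ba : shi_B R m Ha by left; exists a; case: c01 => <-; [left|right].
have Bb : shi_B R m Hb by left; exists b; left.
have Bm : shi_B R m Hm.
  right; exists a, b; split=> //.
  by rewrite /Hm; case: c01 => ->; [apply: Or42|apply: Or44].
have Bp : shi_B R m Hp.
  right; exists a, b; split=> //.
  by rewrite /Hp; case: c01 => ->; [apply: Or41|apply: Or43].
pose pt := pair_row a b; have pta u v : pt u v 0 a = u by exact: pair_rowl.
have ptb u v : pt u v 0 b = v by exact: pair_rowr.
have ne K K' : K (pt c 0) -> K' (pt c 0) -> K `&` K' !=set0.
  by exists (pt c 0).
have [a0 b0 m0 p0] : [/\ Ha (pt c 0), Hb (pt c 0), Hm (pt c 0) & Hp (pt c 0)].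
  by rewrite /Ha /Hb /Hm /Hp /= pta ptb subr0 addr0.
have neq K K' u v : K (pt u v) -> ~ K' (pt u v) -> K <> K' /\ K' <> K.
  by move=> Kx K'x; split=> E; apply: K'x; [rewrite -E|rewrite E].
(* Each pair is told apart by a point on its first line: (c, 1) lies on the
   first only, (c + 1, 0) on the second only, (c + 1, 1) on the third only. *)
have [nab nba] : Ha <> Hb /\ Hb <> Ha.
  by apply: (neq Ha Hb c 1); rewrite /Ha /Hb /= ?pta ?ptb; lra.
have [nam nma] : Ha <> Hm /\ Hm <> Ha.
  by apply: (neq Ha Hm c 1); rewrite /Ha /Hm /= ?pta ?ptb; lra.
have [nap npa] : Ha <> Hp /\ Hp <> Ha.
  by apply: (neq Ha Hp c 1); rewrite /Ha /Hp /= ?pta ?ptb; lra.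
have [nbm nmb] : Hb <> Hm /\ Hm <> Hb.
  by apply: (neq Hb Hm (c + 1) 0); rewrite /Hb /Hm /= ?pta ?ptb; lra.
have [nbp npb] : Hb <> Hp /\ Hp <> Hb.
  by apply: (neq Hb Hp (c + 1) 0); rewrite /Hb /Hp /= ?pta ?ptb; lra.
have [nmp npm] : Hm <> Hp /\ Hp <> Hm.
  by apply: (neq Hm Hp (c + 1) 1); rewrite /Hm /Hp /= ?pta ?ptb; lra.
case=> ->; [exists Hb, Hm, Hp|exists Ha, Hm, Hp|exists Ha, Hb, Hp|exists Ha, Hb, Hm];
  split=> //; try exact: ne;
  by move=> x []; rewrite /Ha /Hb /Hm /Hp /= => h1 h2; split=> /=; lra.
Qed.

(** The hyperplane [x_i = 1] needs an index after [i] as a partner, which the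
    last index lacks; every other hyperplane belongs to a quadruple with
    [c = 0] or [c = 1]. *)
Lemma shi_B_in_quadruple_pencil H : (1 < m)%N -> shi_B R m H ->
  (exists2 i : 'I_m, i.+1 = m & H = [set x : 'rV[R]_m | x 0 i = 1]) \/
  in_quadruple_pencil (shi_B R m) H.
Proof.
move=> m1 [[i [] ->]|[i [j [ij [] ->]]]].
- right; have [i0|i0] := posnP i.
    apply: (@shi_B_quadruple i (Ordinal m1) 0); [by rewrite i0|by left|exact: Or41].
  have m0 : (0 < m)%N by exact: ltnW.
  by apply: (@shi_B_quadruple (Ordinal m0) i 0); [|left|exact: Or42].
- have [im|im] := eqVneq i.+1 m; first by left; exists i.
  right; have im1 : (i.+1 < m)%N by rewrite ltn_neqAle im ltn_ord.
  by apply: (@shi_B_quadruple i (Ordinal im1) 1); [exact: ltnSn|right|exact: Or41].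
- by right; apply: (@shi_B_quadruple i j 0); [|left|exact: Or44].
- by right; apply: (@shi_B_quadruple i j 0); [|left|exact: Or43].
- by right; apply: (@shi_B_quadruple i j 1); [|right|exact: Or44].
- by right; apply: (@shi_B_quadruple i j 1); [|right|exact: Or43].
Qed.

End TypeB.

(** * Type C: the hyperplanes [x_i - x_j = 1] are not rich *)

Section TypeC.
Variables (R : realType) (m : nat).
Implicit Types (H K : set 'rV[R]_m) (i j k l a b : 'I_m) (c s : R).

(** With [k = l] and [s = 1] this is [2 x_k = c], so all positive roots of type
    C take the same form. *)
Definition root_hyperplane k l s c : set 'rV[R]_m :=
  [set x | x 0 k + s * x 0 l = c].

Definition positive_root k l s :=
  (k <= l)%N /\ (s = 1 \/ s = -1 /\ k <> l).

Lemma shi_C_root K : shi_C R m K ->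
  exists k l s c, [/\ positive_root k l s, c = 0 \/ c = 1 & K = root_hyperplane k l s c].
Proof.
have dbl i c : [set x : 'rV[R]_m | 2 * x 0 i = c] = root_hyperplane i i 1 c.
  by apply/funext => x; rewrite /root_hyperplane /=; congr (_ = _); ring.
have add i j c : [set x : 'rV[R]_m | x 0 i + x 0 j = c] = root_hyperplane i j 1 c.
  by apply/funext => x; rewrite /root_hyperplane /=; rewrite mul1r.
have sub i j c : [set x : 'rV[R]_m | x 0 i - x 0 j = c] = root_hyperplane i j (-1) c.
  by apply/funext => x; rewrite /root_hyperplane /=; rewrite mulN1r.
case=> [[i] | [i [j [ij]]]].
  by case=> ->; exists i, i, 1; [exists 0|exists 1]; split; auto; split; auto.
have nij : i <> j by move=> E; rewrite E ltnn in ij.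
have dD : positive_root i j 1 by split; [exact: ltnW|left].
have dB : positive_root i j (-1) by split; [exact: ltnW|right].
by case=> ->; [exists i, j, 1, 0|exists i, j, (-1), 0|exists i, j, 1, 1|
  exists i, j, (-1), 1]; split; auto.
Qed.

Lemma shi_C_hyperplane : shi_C R m `<=` @is_hyperplane R m.
Proof.
move=> K /shi_C_root [k [l [s [c [[_ ds] _ ->]]]]].
have -> : root_hyperplane k l s c = [set x | 1 * x 0 k + s * x 0 l = c].
  by apply/funext => x; rewrite /root_hyperplane /=; rewrite mul1r.
apply: (@is_hyperplane_comb _ _ k l _ _ _ (delta_mx 0 k)); rewrite !mxE !eqxx /=.
by case: ds => [->|[-> /eqP kl]]; [case: (l == k) => /=|rewrite [l == k]eq_sym (negbTE kl)];
  rewrite ?mulr1n ?mulr0n; apply/eqP => E; lra.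
Qed.

(** The indexing of the coordinates on the hyperplane [x_i = x_j + 1], on which
    [x_i] is no longer independent of [x_j]. *)
Definition merge i j k := if k == i then j else k.

(** Every direction [w] tangent to [H] and [K1] is tangent to [K2]: translate
    [p] by [w].  Tangency to [H] means that [w] factors through [merge i j], so
    this compares two linear forms in independent coordinates, and the kernel
    of the first is contained in that of the second.  Therefore the two forms
    have the same sign and involve the same merged coordinates. *)
Lemma shared_flat_merge i j k1 l1 s1 c1 k2 l2 s2 c2 (p : 'rV[R]_m) :
  let H := [set x : 'rV[R]_m | x 0 i - x 0 j = 1] in
  let K1 := root_hyperplane k1 l1 s1 c1 in
  let K2 := root_hyperplane k2 l2 s2 c2 in
  (i < j)%N -> positive_root k1 l1 s1 -> positive_root k2 l2 s2 ->
  H <> K1 -> H <> K2 -> H p -> K1 p -> H `&` K1 `<=` K2 ->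
  s2 = s1 /\
  (merge i j k2 = merge i j k1 /\ merge i j l2 = merge i j l1 \/
   merge i j k2 = merge i j l1 /\ merge i j l2 = merge i j k1).
Proof.
move=> H K1 K2 ij [kl1 ds1] [kl2 ds2] HK1 HK2 Hp K1p sub.
have K2p : K2 p by exact: sub.
have dir (w : 'I_m -> R) : let v := w \o merge i j in
    v k1 + s1 * v l1 = 0 -> v k2 + s2 * v l2 = 0.
  move=> v v1; have v_ij : v i = v j.
    by rewrite /v /= /merge eqxx; case: eqP.
  have : K2 (p + \row_k v k).
    apply: sub; split; rewrite /H /K1 /root_hyperplane /= !mxE.
      by move: Hp; rewrite /H /= v_ij; lra.
    by move: K1p; rewrite /K1 /root_hyperplane /= mulrDr; lra.
  by move: K2p; rewrite /K2 /root_hyperplane /= !mxE mulrDr; lra.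
(* A root with sign -1 whose two indices get merged must be that of [H]; its
   hyperplane passes through [p], so it would be [H] itself. *)
have notH k l s c : positive_root k l s -> H <> root_hyperplane k l s c ->
    root_hyperplane k l s c p -> merge i j k = merge i j l -> s = 1.
  move=> [kl [//|[sE /eqP nkl]]] HK Kp kl'; case: HK.
  have [ki lj] : k = i /\ l = j.
    move: kl'; rewrite /merge; case: eqP => [kE|_]; case: eqP => [lE|_] kl'.
    - by rewrite kE lE eqxx in nkl.
    - by [].
    - by move: kl; rewrite kl' lE leqNgt ij.
    - by rewrite kl' eqxx in nkl.
  move: Kp; rewrite ki lj sE /root_hyperplane /= => pc.
  have -> : c = 1 by move: Hp; rewrite /H /=; lra.
  by apply/funext => x; rewrite /root_hyperplane /=; rewrite mulN1r.
pose e (d k : 'I_m) : R := (k == d)%:R.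
have e1 d : e d d = 1 by rewrite /e eqxx.
have e0 d k : k <> d -> e d k = 0 by rewrite /e => /eqP/negbTE ->.
have s1_sq : s1 * s1 = 1 by case: ds1 => [->|[-> _]]; ring.
have merge1 := notH _ _ _ _ (conj kl1 ds1) HK1 K1p.
have merge2 := notH _ _ _ _ (conj kl2 ds2) HK2 K2p.
move: dir merge1 merge2; rewrite /=.
set a1 := merge i j k1; set b1 := merge i j l1.
set a2 := merge i j k2; set b2 := merge i j l2 => dir merge1 merge2; clearbody a1 b1 a2 b2.
have s2_pm : s2 = 1 \/ s2 = -1 by case: ds2 => [|[]]; auto.
(* Moving along a coordinate absent from [K1] must leave [K2] invariant. *)
have mem d : d <> a1 -> d <> b1 -> d <> a2 /\ d <> b2.
  move=> da1 db1.
  have := dir (e d); rewrite !(e0 d a1) ?(e0 d b1); [|by auto..].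
  rewrite mulr0 addr0 => /(_ erefl).
  have [a2d|/eqP a2d] := eqVneq a2 d; have [b2d|/eqP b2d] := eqVneq b2 d.
  - by rewrite (merge2 (etrans a2d (esym b2d))) a2d b2d e1 => E; exfalso; clear -E; lra.
  - by rewrite a2d e1 e0 // => E; exfalso; clear -E; lra.
  - by rewrite b2d e1 e0 //; case: s2_pm => -> E; exfalso; clear -E; lra.
  - by split; exact: nesym.
have mem_a2 : a2 = a1 \/ a2 = b1.
  have [|/eqP n1] := eqVneq a2 a1; first by left.
  have [|/eqP n2] := eqVneq a2 b1; first by right.
  by have [] := mem _ n1 n2.
have mem_b2 : b2 = a1 \/ b2 = b1.
  have [|/eqP n1] := eqVneq b2 a1; first by left.
  have [|/eqP n2] := eqVneq b2 b1; first by right.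
  by have [] := mem _ n1 n2.
have [ab1|/eqP nab1] := eqVneq a1 b1.
  have a2E : a2 = a1 by rewrite -ab1 in mem_a2; case: mem_a2.
  have b2E : b2 = a1 by rewrite -ab1 in mem_b2; case: mem_b2.
  by rewrite (merge1 ab1) merge2 a2E b2E -?ab1; split=> //; left.
(* This direction preserves [K1] while moving both of its coordinates; it
   forces [K2] to involve both, with the same sign. *)
have := dir (fun k => e a1 k - s1 * e b1 k).
rewrite !e1 (e0 a1 b1) ?(e0 b1 a1) //; last exact: nesym.
have -> : 1 - s1 * 0 + s1 * (0 - s1 * 1) = 1 - s1 * s1 by ring.
rewrite s1_sq subrr => /(_ erefl); case: mem_a2 => a2E; case: mem_b2 => b2E; rewrite a2E b2E.
- by rewrite !e1 (e0 b1 a1) // (merge2 _) ?a2E ?b2E // => E; exfalso; clear -E; lra.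
- rewrite !e1 (e0 b1 a1) // (e0 a1 b1); last exact: nesym.
  move=> E; split; last by left.
  have : s1 * (1 - s2 * s1) = 0 by rewrite -[RHS](mulr0 s1) -E; ring.
  by rewrite mulrBr mulr1 mulrCA s1_sq => {}E; clear -E; lra.
- rewrite !e1 (e0 b1 a1) // (e0 a1 b1); last exact: nesym.
  by move=> E; split; [clear -E; lra|right].
- rewrite e1 (e0 a1 b1); last exact: nesym.
  by rewrite (merge2 _) ?a2E ?b2E //; case: ds1 => [->|[-> _]] E; exfalso; clear -E; lra.
Qed.

(** Merging [i] into [j] identifies at most two ordered pairs of indices, except
    over the pair of [j] and [j], which comes from [(i, i)], [(i, j)] and
    [(j, j)].  So three different pairs with the same image include both
    [(i, i)] and [(j, j)]. *)
Lemma merge_fibers (i j k1 l1 k2 l2 k3 l3 : nat) :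
  let f (k : nat) := if k == i then j else k in
  (i < j)%N -> (k1 <= l1)%N -> (k2 <= l2)%N -> (k3 <= l3)%N ->
  ~ (k1 = k2 /\ l1 = l2) -> ~ (k1 = k3 /\ l1 = l3) -> ~ (k2 = k3 /\ l2 = l3) ->
  f k2 = f k1 /\ f l2 = f l1 \/ f k2 = f l1 /\ f l2 = f k1 ->
  f k3 = f k1 /\ f l3 = f l1 \/ f k3 = f l1 /\ f l3 = f k1 ->
  (k1 = i /\ l1 = i \/ k2 = i /\ l2 = i \/ k3 = i /\ l3 = i) /\
  (k1 = j /\ l1 = j \/ k2 = j /\ l2 = j \/ k3 = j /\ l3 = j).
Proof.
move=> f ij kl1 kl2 kl3 n12 n13 n23; rewrite /f {f}.
case: (k1 =P i) => k1i; case: (l1 =P i) => l1i;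
case: (k2 =P i) => k2i; case: (l2 =P i) => l2i;
case: (k3 =P i) => k3i; case: (l3 =P i) => l3i;
move=> [[e1 e2]|[e1 e2]] [[e3 e4]|[e3 e4]]; subst; lia.
Qed.

(** Three further hyperplanes through a common flat would have roots with the
    same image, hence include one on which [2 x_i] and one on which [2 x_j]
    takes the value 0 or 1; but [2 x_i] exceeds [2 x_j] by 2. *)
Lemma diff_one_not_in_quadruple_pencil i j : (i < j)%N ->
  ~ in_quadruple_pencil (shi_C R m) [set x : 'rV[R]_m | x 0 i - x 0 j = 1].
Proof.
move=> ij [H1 [H2 [H3 [[C1 C2 C3] [n1 n2 n3] [n12 n13 n23] [p [Hp p1]] sub]]]].
have [p2 p3] := sub _ (conj Hp p1).
have [k1 [l1 [s [c1 [d1 c01 E1]]]]] := shi_C_root C1.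
have [k2 [l2 [s2 [c2 [d2 c02 E2]]]]] := shi_C_root C2.
have [k3 [l3 [s3 [c3 [d3 c03 E3]]]]] := shi_C_root C3.
move: n1 n2 n3 n12 n13 n23 sub p1 p2 p3 {C1 C2 C3}; rewrite {}E1 {}E2 {}E3.
move=> n1 n2 n3 n12 n13 n23 sub p1 p2 p3.
have [s2E merge2] := shared_flat_merge ij d1 d2 n1 n2 Hp p1 (fun x xH => (sub x xH).1).
have [s3E merge3] := shared_flat_merge ij d1 d3 n1 n3 Hp p1 (fun x xH => (sub x xH).2).
rewrite {}s2E {}s3E in d2 d3 n12 n13 n23 p2 p3 *.
(* Parallel hyperplanes through the common point [p] coincide, so different
   hyperplanes have different roots. *)
have neq k l c k' l' c' :
    root_hyperplane k l s c p -> root_hyperplane k' l' s c' p ->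
    root_hyperplane k l s c <> root_hyperplane k' l' s c' ->
    ~ (k = k' :> nat /\ l = l' :> nat).
  by rewrite /root_hyperplane /= => <- <- ne [/val_inj kk /val_inj ll]; apply: ne; rewrite kk ll.
pose f (a : nat) : nat := if a == i then (j : nat) else a.
have mergeE k : merge i j k = f k :> nat by rewrite /f /merge -val_eqE; case: ifP.
have mergeP k l :
    merge i j k = merge i j k1 /\ merge i j l = merge i j l1 \/
    merge i j k = merge i j l1 /\ merge i j l = merge i j k1 ->
    f k = f k1 /\ f l = f l1 \/ f k = f l1 /\ f l = f k1.
  by rewrite -!mergeE => -[[-> ->]|[-> ->]]; auto.
have [twice_i twice_j] := merge_fibers ij d1.1 d2.1 d3.1 (neq _ _ _ _ _ _ p1 p2 n12)
  (neq _ _ _ _ _ _ p1 p3 n13) (neq _ _ _ _ _ _ p2 p3 n23)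
  (mergeP _ _ merge2) (mergeP _ _ merge3).
have val a k l c : positive_root k l s -> c = 0 \/ c = 1 ->
    root_hyperplane k l s c p -> k = a :> nat /\ l = a :> nat ->
    2 * p 0 a = 0 \/ 2 * p 0 a = 1.
  move=> [_ ds] c01' Kp [/val_inj ka /val_inj la]; move: ds Kp c01'.
  rewrite {}ka {}la => -[->|[_ //]]; rewrite /root_hyperplane /= => <-.
  by rewrite mul1r -mulr2n mulr_natl.
have val3 a : (k1 = a :> nat /\ l1 = a :> nat \/ k2 = a :> nat /\ l2 = a :> nat \/
    k3 = a :> nat /\ l3 = a :> nat) -> 2 * p 0 a = 0 \/ 2 * p 0 a = 1.
  by case=> [|[]]; [exact: val p1|exact: val p2|exact: val p3].
move: Hp (val3 _ twice_i) (val3 _ twice_j) => /=; clear.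
by move=> Hp [] pi [] pj; lra.
Qed.

End TypeC.

Theorem corollary1p10 (R : realType) (m : nat) (hm : (3 <= m)%N) :
  ~ isomorphic_intersection_posets (shi_B R m) (shi_C R m).
Proof.
have m0 : (0 < m)%N by exact: leq_trans hm.
have m1 : (1 < m)%N by exact: leq_trans hm.
move=> [phi bij mono].
have [_ _ surj] := bij.
have hB := @shi_B_hyperplane R m; have hC := @shi_C_hyperplane R m.
have preimage (j : 'I_m) : (0 < j)%N -> exists i : 'I_m, i.+1 = m /\
    phi [set x : 'rV[R]_m | x 0 i = 1] =
    [set x : 'rV[R]_m | x 0 (Ordinal m0) - x 0 j = 1].
  move=> j0; pose K := [set x : 'rV[R]_m | x 0 (Ordinal m0) - x 0 j = 1].
  have CK : shi_C R m K by right; exists (Ordinal m0), j; split=> //; exact: Or44.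
  have := intersection_poset_hyperplane CK (hyperplane_neq0 (hC _ CK)).
  move=> /surj [H LH HK].
  have BH : shi_B R m H by apply/(isomorphism_hyperplanes hB hC bij mono LH); rewrite HK.
  have [[i im HE]|pencil] := shi_B_in_quadruple_pencil m1 BH.
    by exists i; rewrite -HE.
  have := isomorphism_quadruple_pencil hB hC bij mono BH pencil.
  by rewrite HK => /(@diff_one_not_in_quadruple_pencil R m (Ordinal m0) j j0).
have [i [im E1]] := preimage (Ordinal m1) isT.
have [i' [i'm E2]] := preimage (Ordinal hm) isT.
have ii' : i' = i by apply/val_inj/succn_inj; rewrite im.
(* A point of [x_0 - x_1 = 1] outside of [x_0 - x_2 = 1]. *)
pose y : 'rV[R]_m := \row_k - (k == Ordinal m1)%:R.
have : [set x : 'rV[R]_m | x 0 (Ordinal m0) - x 0 (Ordinal m1) = 1] y.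
  by rewrite /= !mxE eqxx /= oppr0 opprK add0r.
rewrite -E1 -ii' E2 /= !mxE /= oppr0 subr0 => /eqP.
by rewrite eq_sym oner_eq0.
Qed.
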